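(* Let $G=(V,E,d,w)$ be a locally finite weighted graph with weight distribution $w$, and assume $d$ satisfies the Treelike property. Let $x\sim y$ with $D_x\geq D_y$, and let $\alpha\in\big(\frac{w_{xy}}{w_{xy}+D_x},1\big]$. Let $f$ be an optimal Kantorovich potential transporting $\mu_x^\alpha$ to $\mu_y^\alpha$. Then $f(x)-f(y)=d(x,y)$. Moreover, the function $\alpha\mapsto\kappa_\alpha(x,y)$ is linear on $\big[\frac{w_{xy}}{w_{xy}+D_x},1\big]$.
   Context: A weighted graph $G=(V,E,d)$ is a connected, locally finite simple graph with a length function $d\colon E\to(0,\infty)$; for arbitrary vertices $u,v$, $d(u,v)$ is the minimum total length of a path joining them, and it is assumed that for every edge this shortest-path distance equals the edge's length. $N(x)$ is the set of neighbors of $x$ together with $x$. A weight distribution is $w\colon E\to(0,\infty)$, $w_{xy}=w_{yx}$; $D_x=\sum_{z\sim x}w_{xz}$. For $\alpha\in[0,1]$, $\mu_x^\alpha(x)=\alpha$, $\mu_x^\alpha(z)=(1-\alpha)\frac{w_{xz}}{D_x}$ if $z\sim x$, $0$ otherwise. A coupling between probability measures $\mu_1,\mu_2$ is a finitely supported $A\colon V\times V\to[0,1]$ with marginals $\mu_1,\mu_2$; $W(\mu_1,\mu_2)=\inf_A\sum A(u,v)d(u,v)$. A function $f\colon V\to\mathbb{R}$ is Lip(1) if $f(u)-f(v)\le d(u,v)$ for all $u,v\in V$; by duality $W(\mu_1,\mu_2)=\sup_{f\in\mathrm{Lip}(1)}\sum_{u}f(u)(\mu_1(u)-\mu_2(u))$,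 and a Lip(1) function attaining this supremum is an optimal Kantorovich potential transporting $\mu_1$ to $\mu_2$. $\kappa_\alpha(x,y)=1-\frac{W(\mu_x^\alpha,\mu_y^\alpha)}{d(x,y)}$. The distance $d$ satisfies the Treelike property if for every edge $xy$ and all $k\in N(x)\setminus\{y\}$, $l\in N(y)\setminus\{x\}$, $d(k,l)=d(k,x)+d(x,y)+d(y,l)$. *)

(* Defs.v *)
From HB Require Import structures.
From mathcomp Require Import all_boot all_order all_algebra.
From mathcomp Require Import all_classical all_reals.

Set Implicit Arguments.
Unset Strict Implicit.
Unset Printing Implicit Defensive.

Import Order.TTheory GRing.Theory Num.Theory.

Local Open Scope classical_set_scope.
Local Open Scope ring_scope.

(* Vertices form an arbitrary, possibly infinite, choiceType (classically, no
   restriction on the vertex set). A function on edges is a function of two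
   vertices whose values on non-adjacent pairs are never constrained or used.
   Finite sums over V are \sum_(u \in A) F u, i.e. sums over the support of F
   in A; by local finiteness, all the supports below are finite. *)

Section Distance.
Variables (R : realType) (V : choiceType).

(* pairmap len u p lists the lengths of the consecutive edges of u :: p. *)
Definition path_length (len : V -> V -> R) (u : V) (p : seq V) : R :=
  \sum_(l <- pairmap len u p) l.

(* An infimum, so that no attainment assumption is needed; it is the minimum
   whenever a shortest path exists. *)
Definition path_dist (adj : rel V) (len : V -> V -> R) (u v : V) : R :=
  inf [set path_length len u p | p in [set p | path adj u p /\ last u p = v]].

End Distance.

Record weighted_graph (R : realType) (V : choiceType) := WeightedGraph {
  adj : rel V;
  adj_sym : symmetric adj;
  adj_irr : irreflexive adj;
  adj_locally_finite : forall x, finite_set [set z | adj x z];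
  adj_connected : forall u v, exists p, path adj u p /\ last u p = v;
  len : V -> V -> R;
  len_gt0 : forall x y, adj x y -> 0 < len x y;
  len_sym : forall x y, adj x y -> len x y = len y x;
  len_dist : forall x y, adj x y -> path_dist adj len x y = len x y
}.

Record weight_distribution (R : realType) (V : choiceType)
    (G : weighted_graph R V) := WeightDistribution {
  weight :> V -> V -> R;
  weight_gt0 : forall x y, adj G x y -> 0 < weight x y;
  weight_sym : forall x y, adj G x y -> weight x y = weight y x
}.

Section Curvature.
Variables (R : realType) (V : choiceType) (G : weighted_graph R V).

Definition dist (u v : V) : R := path_dist (adj G) (len G) u v.

Definition closed_nbhd (x : V) : set V := [set z | z = x \/ adj G x z].

Definition treelike : Prop :=
  forall x y, adj G x y ->
  forall k l, (closed_nbhd x `\ y) k -> (closed_nbhd y `\ x) l ->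
    dist k l = dist k x + dist x y + dist y l.

Definition coupling (mu1 mu2 : V -> R) (A : V * V -> R) : Prop :=
  [/\ forall p, 0 <= A p <= 1,
      finite_set [set p | A p != 0],
      forall u, \sum_(v \in [set: V]) A (u, v) = mu1 u
    & forall v, \sum_(u \in [set: V]) A (u, v) = mu2 v].

Definition transport_cost (A : V * V -> R) : R :=
  \sum_(p \in [set: V * V]) A p * dist p.1 p.2.

Definition wasserstein (mu1 mu2 : V -> R) : R :=
  inf [set transport_cost A | A in coupling mu1 mu2].

Definition Lip1 (f : V -> R) : Prop := forall u v, f u - f v <= dist u v.

Definition kantorovich (mu1 mu2 f : V -> R) : R :=
  \sum_(u \in [set: V]) f u * (mu1 u - mu2 u).

Definition optimal_potential (mu1 mu2 f : V -> R) : Prop :=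
  Lip1 f /\ kantorovich mu1 mu2 f = sup [set kantorovich mu1 mu2 g | g in Lip1].

Variable w : weight_distribution G.

Definition wdeg (x : V) : R := \sum_(z \in [set z | adj G x z]) w x z.

Definition mu (alpha : R) (x z : V) : R :=
  if z == x then alpha
  else if adj G x z then (1 - alpha) * (w x z / wdeg x)
  else 0.

Definition kappa (alpha : R) (x y : V) : R :=
  1 - wasserstein (mu alpha x) (mu alpha y) / dist x y.

End Curvature.

(* Linear in the sense of having a straight-line graph, with an intercept
   (kappa vanishes at alpha = 1, so linear cannot mean homogeneous). *)
Definition linear_on (R : realType) (I : interval R) (g : R -> R) : Prop :=
  exists a b : R, forall t, t \in I -> g t = a * t + b.

(* Main.v *)
(* The potential [tree_potential], which is d(k,x) + d(x,y) on N(x) minus y and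
   -d(y,l) on N(y) minus x, does not depend on alpha. Above the threshold,
   p = mu_x(y) is at most alpha = mu_y(y), so the mass p can stay at y while the
   rest of mu_x is coupled independently with the rest of mu_y; no mass then
   moves from y to x, and by the treelike property the potential is tight on the
   support of this coupling. Both are therefore optimal: the Wasserstein distance
   is the value of a fixed function against mu_x - mu_y, which is affine in
   alpha. Strictly above the threshold the coupling moves mass from x to y, so by
   complementary slackness every optimal potential is tight on (x, y). *)
Require Import Defs.
From HB Require Import structures.
From mathcomp Require Import all_boot all_order all_algebra.
From mathcomp Require Import all_classical all_reals.
From mathcomp Require Import ring lra.

Import Order.TTheory GRing.Theory Num.Theory.

Local Open Scope classical_set_scope.
Local Open Scope ring_scope.

Set Implicit Arguments.
Unset Strict Implicit.
Unset Printing Implicit Defensive.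

(** * Sums of finitely supported functions *)

Lemma fsumT_finite (R : realType) (T : choiceType) (X : set T) (f : T -> R) :
  (forall t, f t != 0 -> X t) ->
  \sum_(t \in [set: T]) f t = \sum_(t \in X) f t.
Proof.
move=> fX; apply/esym/fsbig_widen => // t [_ nXt] /=.
by have [->|/fX] := eqVneq (f t) 0.
Qed.

Lemma fsumT_term_le (R : realType) (T : choiceType) (f : T -> R) (t : T) :
  (forall s, 0 <= f s) -> finite_set [set s | f s != 0] ->
  f t <= \sum_(s \in [set: T]) f s.
Proof.
move=> f0 fin; rewrite (@fsumT_finite R T (t |` [set s | f s != 0])); last first.
  by move=> s; right.
rewrite (fsbigD1 t)//=; last 2 first.
- by rewrite finite_setU; split.
- by left.
by rewrite lerDl fsumr_ge0.
Qed.

(** * The shortest-path distance as a pseudometric *)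

Section PathMetric.
Variables (R : realType) (V : choiceType) (G : weighted_graph R V).
Implicit Types (u v t : V) (p q : seq V).

Lemma path_length_cons u v p :
  path_length (len G) u (v :: p) = len G u v + path_length (len G) v p.
Proof. by rewrite /path_length /= big_cons. Qed.

Lemma path_length_cat u p q :
  path_length (len G) u (p ++ q) =
  path_length (len G) u p + path_length (len G) (last u p) q.
Proof.
elim: p u => [|v p IH] u /=; first by rewrite {2}/path_length big_nil add0r.
by rewrite !path_length_cons IH addrA.
Qed.

Lemma path_length_ge0 u p : path (adj G) u p -> 0 <= path_length (len G) u p.
Proof.
elim: p u => [|v p IH] u /=; first by rewrite /path_length big_nil.
by case/andP => uv /IH; rewrite path_length_cons; apply/addr_ge0/ltW/len_gt0.
Qed.

Lemma dist_le_path u p :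
  path (adj G) u p -> dist G u (last u p) <= path_length (len G) u p.
Proof.
move=> up; apply: ge_inf; last by exists p.
by exists 0 => _ [q [uq _] <-]; apply: path_length_ge0.
Qed.

Lemma le_dist u v (r : R) :
  (forall p, path (adj G) u p -> last u p = v -> r <= path_length (len G) u p) ->
  r <= dist G u v.
Proof.
move=> lb; apply: lb_le_inf => [|_ [p [up pv] <-]]; last exact: lb.
by have [p hp] := adj_connected G u v; exists (path_length (len G) u p), p.
Qed.

Lemma dist_ge0 u v : 0 <= dist G u v.
Proof. by apply: le_dist => p up _; apply: path_length_ge0. Qed.

Lemma dist_refl u : dist G u u = 0.
Proof.
apply/eqP; rewrite eq_le dist_ge0 andbT.
by apply: le_trans (@dist_le_path u [::] isT) _; rewrite /path_length big_nil.
Qed.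

Lemma dist_triangle u v t : dist G u t <= dist G u v + dist G v t.
Proof.
(* The distance is an infimum, so the two distances on the right are replaced one after the other by
   lengths of arbitrary paths, which are then concatenated. *)
rewrite addrC -lerBlDr; apply: le_dist => q vq qt.
rewrite lerBlDr addrC -lerBlDr; apply: le_dist => p up pv.
rewrite lerBlDr -{1}pv -path_length_cat.
have -> : t = last u (p ++ q) by rewrite last_cat pv.
by apply: dist_le_path; rewrite cat_path up pv.
Qed.

End PathMetric.

(** * Kantorovich duality against a given coupling *)

Section Duality.
Variables (R : realType) (V : choiceType) (G : weighted_graph R V).
Variables (mu1 mu2 : V -> R) (A : V * V -> R).
Hypothesis couplingA : coupling mu1 mu2 A.

(** Both marginals are expanded as sums of [A]; exchanging the order of summation in the second one
    merges them. *)
Lemma kantorovich_coupling (f : V -> R) :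
  kantorovich mu1 mu2 f = \sum_(p \in [set: V * V]) A p * (f p.1 - f p.2).
Proof.
case: couplingA => _ finA row col.
set S := [set p | A p != 0] in finA.
(* A finite set containing both projections of the support lets every sum run over the one square
   [X * X]. *)
set X := (fst @` S) `|` (snd @` S).
have finX : finite_set X by rewrite finite_setU; split; apply: finite_image.
have AX1 u v : A (u, v) != 0 -> X u by move=> uv; left; exists (u, v).
have AX2 u v : A (u, v) != 0 -> X v by move=> uv; right; exists (u, v).
have rowX u : mu1 u = \sum_(v \in X) A (u, v).
  by rewrite -row; apply: fsumT_finite => v; apply: AX2.
have colX v : mu2 v = \sum_(u \in X) A (u, v).
  by rewrite -col; apply: fsumT_finite => u; apply: AX1.
rewrite /kantorovich (@fsumT_finite _ _ X); last first.
  move=> u; apply: contra_neqP => nXu.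
  rewrite rowX colX !fsbig1 ?subrr ?mulr0// => v _.
  - by apply: contra_notP nXu => /eqP; apply: AX2.
  - by apply: contra_notP nXu => /eqP; apply: AX1.
rewrite (@fsumT_finite _ _ (X `*` X)); last first.
  move=> [u v]; rewrite mulf_eq0 negb_or => /andP[uv _].
  by split; [exact: AX1 uv|exact: AX2 uv].
have -> : \sum_(p \in X `*` X) A p * (f p.1 - f p.2) =
    \sum_(u \in X) \sum_(v \in X) A (u, v) * (f u - f v).
  by rewrite pair_fsbig//; apply: eq_fsbigr => -[].
under eq_fsbigr do rewrite rowX colX.
rewrite !fsbig_finite//=.
under eq_bigr do rewrite !fsbig_finite//= mulrBr !mulr_sumr.
under [RHS]eq_bigr do rewrite fsbig_finite//=.
rewrite sumrB [X in _ - X]exchange_big -sumrB; apply: eq_bigr => u _ /=.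
by rewrite -sumrB; apply: eq_bigr => v _; ring.
Qed.

(** The duality gap as a sum over pairs, whose terms are all nonnegative once [f] is 1-Lipschitz. *)
Lemma transport_costB (f : V -> R) :
  transport_cost G A - kantorovich mu1 mu2 f =
  \sum_(p \in [set: V * V]) A p * (dist G p.1 p.2 - (f p.1 - f p.2)).
Proof.
have [_ finA _ _] := couplingA.
rewrite kantorovich_coupling /transport_cost.
have supp g : \sum_(p \in [set: V * V]) A p * g p =
    \sum_(p \in [set p | A p != 0]) A p * g p.
  by apply: fsumT_finite => p; apply: contraNN => /eqP ->; rewrite mul0r.
rewrite !supp !fsbig_finite// -sumrB.
by apply: eq_bigr => p _; rewrite -mulrBr.
Qed.

Lemma weak_duality (f : V -> R) :
  Lip1 G f -> kantorovich mu1 mu2 f <= transport_cost G A.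
Proof.
move=> lipf; rewrite -subr_ge0 transport_costB fsumr_ge0// => p _.
have [/(_ p)/andP[A0 _] _ _ _] := couplingA.
by rewrite mulr_ge0// subr_ge0 lipf.
Qed.

(** A duality gap that is at most zero, being a sum of nonnegative terms, forces each term to
    vanish; where [A] has mass, the other factor must be zero. *)
Lemma complementary_slackness (f : V -> R) (u v : V) :
  Lip1 G f -> transport_cost G A <= kantorovich mu1 mu2 f ->
  A (u, v) != 0 -> f u - f v = dist G u v.
Proof.
move=> lipf leK uv; have [A01 finA _ _] := couplingA.
have g0 p : 0 <= A p * (dist G p.1 p.2 - (f p.1 - f p.2)).
  by have /andP[A0 _] := A01 p; rewrite mulr_ge0// subr_ge0 lipf.
have fing : finite_set [set p | A p * (dist G p.1 p.2 - (f p.1 - f p.2)) != 0].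
  by apply: sub_finite_set finA => p /=; rewrite mulf_eq0 negb_or => /andP[].
have := fsumT_term_le (u, v) g0 fing.
rewrite -transport_costB /= => /le_trans /(_ (_ : _ <= 0)).
rewrite subr_le0 => /(_ leK) le0.
have /eqP : A (u, v) * (dist G u v - (f u - f v)) = 0.
  by apply/eqP; rewrite eq_le le0 (g0 (u, v)).
by rewrite mulf_eq0 (negbTE uv) subr_eq0 => /eqP ->.
Qed.

Lemma tight_kantorovich (f : V -> R) :
  (forall u v, A (u, v) != 0 -> f u - f v = dist G u v) ->
  kantorovich mu1 mu2 f = transport_cost G A.
Proof.
move=> tight; apply/esym/eqP; rewrite -subr_eq0 transport_costB; apply/eqP.
rewrite fsbig1// => -[u v] _ /=.
by have [->|/tight ->] := eqVneq (A (u, v)) 0; rewrite ?mul0r ?subrr ?mulr0.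
Qed.

Section TightPair.
Variable f : V -> R.
Hypotheses (lipf : Lip1 G f)
  (tight : forall u v, A (u, v) != 0 -> f u - f v = dist G u v).

Lemma optimal_tight (g : V -> R) (u v : V) :
  optimal_potential G mu1 mu2 g -> A (u, v) != 0 -> g u - g v = dist G u v.
Proof.
case=> lipg optg; apply: complementary_slackness => //.
(* The tight [f] shows that the supremum is at least the cost of [A]; weak duality supplies the
   upper bound without which [sup] would carry no information. *)
rewrite optg -(tight_kantorovich tight); apply: ub_le_sup; last by exists f.
by exists (transport_cost G A) => _ [h liph <-]; apply: weak_duality.
Qed.

End TightPair.
End Duality.

(** Weak duality bounds every coupling below by the value of [f], and tightness makes [A] attain
    this bound. *)
Lemma wasserstein_tight (R : realType) (V : choiceType) (G : weighted_graph R V)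
    (mu1 mu2 : V -> R) (A : V * V -> R) (f : V -> R) :
  coupling mu1 mu2 A -> Lip1 G f ->
  (forall u v, A (u, v) != 0 -> f u - f v = dist G u v) ->
  wasserstein G mu1 mu2 = kantorovich mu1 mu2 f.
Proof.
move=> cA lipf tight.
have lb B : coupling mu1 mu2 B -> kantorovich mu1 mu2 f <= transport_cost G B.
  by move=> cB; apply: weak_duality.
apply/eqP; rewrite eq_le; apply/andP; split.
  rewrite (@tight_kantorovich _ _ G _ _ A)//; apply: ge_inf; last by exists A.
  by exists (kantorovich mu1 mu2 f) => _ [B cB <-]; apply: lb.
apply: lb_le_inf => [|_ [B cB <-]]; last exact: lb.
by exists (transport_cost G A), A.
Qed.

(** * Couplings that keep a prescribed mass in place *)

Section AnchoredCoupling.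
Variables (R : realType) (V : choiceType).
Implicit Types (mu : V -> R) (y : V) (p : R).

(* Mass [p] stays at [y]; the remaining masses, both of total [1 - p], are coupled
   by the product measure. *)
Definition anchored_coupling mu1 mu2 y p (uv : V * V) : R :=
  (mu1 uv.1 - p * (uv.1 == y)%:R) * (mu2 uv.2 - p * (uv.2 == y)%:R) / (1 - p)
  + p * (uv.1 == y)%:R * (uv.2 == y)%:R.

Definition proba mu : Prop :=
  [/\ forall u, 0 <= mu u, finite_set [set u | mu u != 0]
    & \sum_(u \in [set: V]) mu u = 1].

(** This symmetry reduces statements about columns to statements about rows. *)
Lemma anchored_couplingC mu1 mu2 y p u v :
  anchored_coupling mu1 mu2 y p (u, v) = anchored_coupling mu2 mu1 y p (v, u).
Proof. by rewrite /anchored_coupling /=; ring. Qed.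

Lemma anchored_coupling_ge0 mu1 mu2 y p uv :
  proba mu1 -> proba mu2 -> 0 <= p < 1 -> p <= mu1 y -> p <= mu2 y ->
  0 <= anchored_coupling mu1 mu2 y p uv.
Proof.
move=> [mu1_ge0 _ _] [mu2_ge0 _ _] /andP[p0 p1] p_mu1 p_mu2.
have rest_ge0 mu u : (forall v, 0 <= mu v) -> p <= mu y ->
    0 <= mu u - p * (u == y)%:R.
  by move=> mu0 pmu; case: eqVneq => [->|_]; rewrite ?mulr1 ?mulr0 ?subr0 ?subr_ge0.
rewrite /anchored_coupling addr_ge0//; last by rewrite !mulr_ge0.
by rewrite divr_ge0 ?mulr_ge0 ?rest_ge0// subr_ge0 ltW.
Qed.

Lemma anchored_coupling_row mu1 mu2 y p u :
  proba mu2 -> p < 1 ->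
  \sum_(v \in [set: V]) anchored_coupling mu1 mu2 y p (u, v) = mu1 u.
Proof.
move=> [_ fin2 sum2] p1.
(* For fixed [u], the row is [b] times [mu2] plus [c] times the Dirac mass at [y], so it sums to
   [b + c], which is [mu1 u]. *)
set b := (mu1 u - p * (u == y)%:R) / (1 - p).
set c := p * (u == y)%:R - b * p.
have AE v : anchored_coupling mu1 mu2 y p (u, v) = b * mu2 v + c * (v == y)%:R.
  by rewrite /anchored_coupling /c /b /=; ring.
set X := y |` [set v | mu2 v != 0].
have finX : finite_set X by rewrite finite_setU; split.
rewrite (@fsumT_finite _ _ X) => [|v]; last first.
  apply: contra_neqP => nXv; rewrite AE.
  have -> : mu2 v = 0 by apply: contra_notP nXv => /eqP; right.
  have /negbTE -> : v != y by apply/eqP => vy; apply: nXv; left.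
  by rewrite !mulr0 addr0.
under eq_fsbigr do rewrite AE.
rewrite fsbig_split//= -!mulr_fsumr.
have -> : \sum_(v \in X) mu2 v = 1.
  by rewrite -sum2; apply/esym/fsumT_finite => v; right.
have -> : \sum_(v \in X) ((v == y)%:R : R) = 1.
  rewrite (fsbigD1 y)//=; last by left.
  by rewrite eqxx fsbig1 ?addr0// => v [_ /eqP/negbTE ->].
by rewrite /c /b; field; rewrite subr_eq0 eq_sym lt_eqF.
Qed.

Lemma coupling_anchored mu1 mu2 y p :
  proba mu1 -> proba mu2 -> 0 <= p < 1 -> p <= mu1 y -> p <= mu2 y ->
  coupling mu1 mu2 (anchored_coupling mu1 mu2 y p).
Proof.
move=> P1 P2 p01 pmu1 pmu2; have /andP[p0 p1] := p01.
have A0 q : 0 <= anchored_coupling mu1 mu2 y p q by apply: anchored_coupling_ge0.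
have supp mu mu' u v : anchored_coupling mu mu' y p (u, v) != 0 ->
    (y |` [set u | mu u != 0]) u.
  apply: contra_neqP => nXu; rewrite /anchored_coupling /=.
  have -> : mu u = 0 by apply: contra_notP nXu => /eqP; right.
  have /negbTE -> : u != y by apply/eqP => uy; apply: nXu; left.
  by rewrite !(mulr0, mul0r, subr0, addr0).
have finA : finite_set [set q | anchored_coupling mu1 mu2 y p q != 0].
  have [_ fin1 _] := P1; have [_ fin2 _] := P2.
  apply: (@sub_finite_set _ _
    ((y |` [set v | mu1 v != 0]) `*` (y |` [set v | mu2 v != 0]))).
    move=> [u v] uv; split; first exact: supp uv.
    by move: uv; rewrite /= anchored_couplingC; apply: supp.
  by apply: finite_setX; rewrite finite_setU; split.
have row u : \sum_(v \in [set: V]) anchored_coupling mu1 mu2 y p (u, v) = mu1 u.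
  exact: anchored_coupling_row.
split=> // [[u v]|v]; last first.
  under eq_fsbigr do rewrite anchored_couplingC.
  exact: anchored_coupling_row.
(* An entry is at most its row sum [mu1 u], which is at most the total mass 1. *)
rewrite A0 /=; apply: le_trans (_ : mu1 u <= 1).
  rewrite -row; apply: (@fsumT_term_le _ _ (fun v => _ (u, v))) => //.
  apply: sub_finite_set (finite_image snd finA) => t ut.
  by exists (u, t).
by have [mu0 fin1 <-] := P1; apply: fsumT_term_le.
Qed.

End AnchoredCoupling.

(** * The lazy random walk measures and their dependence on the idleness *)

Section Measures.
Variables (R : realType) (V : choiceType) (G : weighted_graph R V).
Variable w : weight_distribution G.

Lemma wdeg_gt0 (x y : V) : adj G x y -> 0 < wdeg w x.
Proof.
move=> xy; rewrite /wdeg (fsbigD1 y)//=; last exact: adj_locally_finite.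
rewrite ltr_pwDl ?weight_gt0// fsumr_ge0// => z [xz _].
exact/ltW/weight_gt0.
Qed.

Lemma proba_mu (alpha : R) (x : V) :
  0 <= alpha <= 1 -> 0 < wdeg w x -> proba (mu w alpha x).
Proof.
move=> /andP[a0 a1] D0.
have finN := adj_locally_finite G x.
have supp z : mu w alpha x z != 0 -> ([set x] `|` [set z | adj G x z]) z.
  rewrite /mu; case: (eqVneq z x) => [->|_]; first by left.
  by case: ifP => [xz|]; [right|rewrite eqxx].
have finX : finite_set ([set x] `|` [set z | adj G x z]).
  by rewrite finite_setU; split.
split.
- move=> z; rewrite /mu; case: ifP => // _; case: ifP => // xz.
  by rewrite mulr_ge0 ?subr_ge0// divr_ge0// ltW// weight_gt0.
- exact: sub_finite_set finX.
rewrite (fsumT_finite supp) fsbigU0//; last first.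
  by move=> _ [-> /=]; rewrite adj_irr.
rewrite fsbig_set1 {1}/mu eqxx.
have -> : \sum_(z \in [set z | adj G x z]) mu w alpha x z =
    \sum_(z \in [set z | adj G x z]) (1 - alpha) / wdeg w x * w x z.
  apply: eq_fsbigr => z /set_mem /= xz; rewrite /mu xz.
  have /negbTE -> : z != x by apply: contraTneq xz => ->; rewrite adj_irr.
  by ring.
by rewrite -mulr_fsumr -/(wdeg w x) divfK ?gt_eqF//= addrC subrK.
Qed.

(** The measure interpolates between the Dirac mass at [x] (idleness 1) and the non-lazy step
    (idleness 0). *)
Lemma mu_affine (alpha : R) (x z : V) :
  mu w alpha x z = alpha * mu w 1 x z + (1 - alpha) * mu w 0 x z.
Proof. by rewrite /mu; case: ifP => _; [|case: ifP => _]; ring. Qed.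

Lemma kantorovich_mu_affine (alpha : R) (x y : V) (f : V -> R) :
  kantorovich (mu w alpha x) (mu w alpha y) f =
  alpha * kantorovich (mu w 1 x) (mu w 1 y) f +
  (1 - alpha) * kantorovich (mu w 0 x) (mu w 0 y) f.
Proof.
set X := (x |` [set z | adj G x z]) `|` (y |` [set z | adj G y z]).
have finX : finite_set X.
  by rewrite !finite_setU; split; split=> //; exact: adj_locally_finite.
have E a : kantorovich (mu w a x) (mu w a y) f =
    \sum_(z \in X) f z * (mu w a x z - mu w a y z).
  apply: fsumT_finite => z.
  apply: contra_neqP => /not_orP[nx ny].
  have mu0 t : ~ (z = t \/ adj G t z) -> mu w a t z = 0.
    by move=> /not_orP[/eqP/negbTE zt /negP/negbTE tz]; rewrite /mu zt tz.
  by rewrite !mu0// subrr mulr0.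
rewrite !E !mulr_fsumr -fsbig_split//=; apply: eq_fsbigr => z _.
by rewrite (mu_affine alpha x) (mu_affine alpha y); ring.
Qed.

End Measures.

(** * The potential attached to an edge *)

Section TreelikePotential.
Variables (R : realType) (V : choiceType) (G : weighted_graph R V) (x y : V).
Implicit Types u v k l : V.

(** A McShane extension: the largest 1-Lipschitz function with value [- dist G y l] at each [l] of
    N(y) minus x. The infimum gives a function on all of [V] without describing the global shape of
    the graph. *)
Definition tree_potential v : R :=
  inf [set dist G v l - dist G y l | l in closed_nbhd G y `\ x].

Lemma tree_potential_le v l : (closed_nbhd G y `\ x) l ->
  tree_potential v <= dist G v l - dist G y l.
Proof.
move=> yl; apply: ge_inf; last by exists l.
(* The triangle inequality makes this a lower bound of the set, as the use of [inf] requires. *)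
exists (- dist G y v) => _ [t _ <-].
by have := dist_triangle G y v t; lra.
Qed.

Hypothesis xy : adj G x y.

Let yNx : y <> x.
Proof. by move=> yx; move: xy; rewrite yx adj_irr. Qed.

Lemma le_tree_potential v (r : R) :
  (forall l, (closed_nbhd G y `\ x) l -> r <= dist G v l - dist G y l) ->
  r <= tree_potential v.
Proof.
move=> lb; apply: lb_le_inf => [|_ [l yl <-]]; last exact: lb.
by exists (dist G v y - dist G y y), y => //; split=> //; left.
Qed.

Lemma Lip1_tree_potential : Lip1 G tree_potential.
Proof.
move=> u v; rewrite lerBlDl -lerBlDr; apply: le_tree_potential => l yl.
have := tree_potential_le u yl; have := dist_triangle G u v l.
by lra.
Qed.

Lemma tree_potential_target l : (closed_nbhd G y `\ x) l ->
  tree_potential l = - dist G y l.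
Proof.
move=> yl; apply/eqP; rewrite eq_le; apply/andP; split.
  by have := tree_potential_le l yl; rewrite dist_refl sub0r.
apply: le_tree_potential => t yt.
by have := dist_triangle G y l t; lra.
Qed.

Hypothesis tree : treelike G.

(** By the treelike property every element of the set under the infimum equals
    [dist G k x + dist G x y]; the element given by [l = y] yields the upper bound. *)
Lemma tree_potential_source k : (closed_nbhd G x `\ y) k ->
  tree_potential k = dist G k x + dist G x y.
Proof.
move=> xk; apply/eqP; rewrite eq_le; apply/andP; split.
  have yy : (closed_nbhd G y `\ x) y by split=> //; left.
  apply: le_trans (tree_potential_le k yy) _.
  by rewrite (tree xy xk yy) dist_refl; lra.
by apply: le_tree_potential => t yt; rewrite (tree xy xk yt); lra.
Qed.

End TreelikePotential.

(** * The optimal coupling across the edge and the threshold *)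

Section Treelike.
Variables (R : realType) (V : choiceType) (G : weighted_graph R V).
Variables (w : weight_distribution G) (x y : V).
Hypotheses (tree : treelike G) (xy : adj G x y).

Let wxy0 : 0 < w x y. Proof. exact: weight_gt0. Qed.

Let Dx0 : 0 < wdeg w x. Proof. exact: wdeg_gt0 xy. Qed.

Let Dy0 : 0 < wdeg w y. Proof. by apply: (@wdeg_gt0 _ _ _ _ y x); rewrite adj_sym. Qed.

Let xNy : (x == y) = false.
Proof. by apply/eqP => e; move: xy; rewrite e adj_irr. Qed.

Let A alpha := anchored_coupling (mu w alpha x) (mu w alpha y) y (mu w alpha x y).

Lemma mu_support alpha u v : mu w alpha u v != 0 -> closed_nbhd G u v.
Proof.
rewrite /mu; case: (eqVneq v u) => [->|_]; first by left.
by case: ifP => [uv|]; [right|rewrite eqxx].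
Qed.

Lemma edge_coupling_tight alpha u v :
  A alpha (u, v) != 0 ->
  tree_potential G x y u - tree_potential G x y v = dist G u v.
Proof.
rewrite /A /anchored_coupling /=.
(* Since the anchored mass is all of [mu w alpha x y], the product part vanishes on row [y], and
   only the pair [(y, y)] can be charged there. *)
have [->|uy] := eqVneq u y.
  rewrite !mulr1 subrr !mul0r add0r.
  case: (eqVneq v y) => [->|_]; last by rewrite mulr0 eqxx.
  by rewrite subrr dist_refl.
rewrite !mulr0 subr0 mul0r addr0 !mulf_eq0 !negb_or => /andP[/andP[ux vy] _].
have xu : (closed_nbhd G x `\ y) u by split; [exact: mu_support ux|exact/eqP].
rewrite (tree_potential_source xy tree xu).
have xx : (closed_nbhd G x `\ y) x by split; [left|apply/eqP; rewrite xNy].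
(* The target [x] lies outside N(y) minus x, so its potential comes from the source formula and the
   difference is [dist G u x]. *)
have [->|vx] := eqVneq v x.
  by rewrite (tree_potential_source xy tree xx) dist_refl; ring.
have yv : (closed_nbhd G y `\ x) v.
  split; last exact/eqP.
  have [->|vNy] := eqVneq v y; first by left.
  by move: vy; rewrite (negbTE vNy) mulr0 subr0 => /mu_support.
rewrite (tree_potential_target xy yv) (tree xy xu yv).
by ring.
Qed.

Lemma threshold_gt0 : 0 < w x y / (w x y + wdeg w x).
Proof. by rewrite divr_gt0// addr_gt0. Qed.

(** Origin of the threshold: with D the degree of [x], (1 - alpha) w / D <= alpha rearranges to w <=
    alpha (w + D). *)
Lemma mu_threshold alpha :
  (mu w alpha x y <= alpha) = (w x y / (w x y + wdeg w x) <= alpha).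
Proof.
rewrite /mu eq_sym xNy xy ler_pdivrMr ?addr_gt0// mulrA ler_pdivrMr//.
by rewrite mulrBl mul1r mulrDr lerBlDl.
Qed.

Lemma mu_threshold_lt alpha :
  (mu w alpha x y < alpha) = (w x y / (w x y + wdeg w x) < alpha).
Proof.
rewrite /mu eq_sym xNy xy ltr_pdivrMr ?addr_gt0// mulrA ltr_pdivrMr//.
by rewrite mulrBl mul1r mulrDr ltrBlDl.
Qed.

Lemma mu_edge_bounds alpha : w x y / (w x y + wdeg w x) <= alpha <= 1 ->
  0 <= mu w alpha x y < 1.
Proof.
move=> /andP[ta a1]; have muE : mu w alpha x y = (1 - alpha) * (w x y / wdeg w x).
  by rewrite /mu eq_sym xNy xy.
apply/andP; split; first by rewrite muE mulr_ge0 ?subr_ge0// divr_ge0// ltW.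
(* The strict bound keeps the denominator [1 - p] of the coupling nonzero. At [alpha = 1] the mass
   at [y] is 0; otherwise it is at most [alpha], which is below 1. *)
have [->|aN1] := eqVneq alpha 1; first by rewrite /mu eq_sym xNy xy subrr mul0r.
by apply: le_lt_trans (_ : alpha < 1); rewrite ?mu_threshold// lt_neqAle aN1.
Qed.

Lemma edge_coupling alpha : w x y / (w x y + wdeg w x) <= alpha <= 1 ->
  coupling (mu w alpha x) (mu w alpha y) (A alpha).
Proof.
move=> a; have /andP[ta a1] := a.
have a01 : 0 <= alpha <= 1 by rewrite a1 (le_trans (ltW threshold_gt0)).
apply: coupling_anchored => //; [exact: proba_mu..|exact: mu_edge_bounds|].
by rewrite {2}/mu eqxx mu_threshold.
Qed.

End Treelike.

Unset Implicit Arguments.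
Set Strict Implicit.
Set Printing Implicit Defensive.

Theorem theorem2p10 (R : realType) (V : choiceType) (G : weighted_graph R V)
    (w : weight_distribution G) (x y : V) :
  treelike G -> adj G x y -> wdeg w y <= wdeg w x ->
  (forall (alpha : R) (f : V -> R),
     alpha \in `](w x y / (w x y + wdeg w x)), 1] ->
     optimal_potential G (mu w alpha x) (mu w alpha y) f ->
     f x - f y = dist G x y) /\
  linear_on `[(w x y / (w x y + wdeg w x)), 1] (fun alpha => kappa w alpha x y).
Proof.
move=> tree xy _.
have lipf := Lip1_tree_potential xy.
have tight alpha := edge_coupling_tight (w := w) (alpha := alpha) tree xy.
split=> [alpha f|].
  rewrite in_itv /= => /andP[ta a1] optf.
  have a : w x y / (w x y + wdeg w x) <= alpha <= 1 by rewrite ltW.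
  apply: (optimal_tight (edge_coupling xy a) lipf (tight alpha) optf).
  have xNy : (x == y) = false by apply/eqP => e; move: xy; rewrite e adj_irr.
  (* With p = [mu w alpha x y], the coupling has mass alpha (alpha - p) / (1 - p) at [(x, y)], which
     is positive strictly above the threshold. *)
  rewrite /anchored_coupling /= xNy eqxx !mulr1 mulr0 subr0 addr0.
  have [] := andP (mu_edge_bounds xy a) => _ p1.
  have pa : mu w alpha x y < alpha by rewrite mu_threshold_lt.
  have muE u : mu w alpha u u = alpha by rewrite /mu eqxx.
  have a0 : 0 < alpha by apply: lt_trans ta; apply: threshold_gt0.
  by rewrite gt_eqF// divr_gt0 ?subr_gt0// mulr_gt0 ?muE// subr_gt0.
pose K a := kantorovich (mu w a x) (mu w a y) (tree_potential G x y).
(* Slope and intercept are read off from K a = a K 1 + (1 - a) K 0, where [K a] is the Wasserstein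
   distance for [a] in the interval. *)
exists (- (K 1 - K 0) / dist G x y), (1 - K 0 / dist G x y) => alpha.
rewrite in_itv /= => a; rewrite /kappa.
rewrite (wasserstein_tight (edge_coupling xy a) lipf (tight alpha)).
by rewrite kantorovich_mu_affine -/(K 1) -/(K 0); ring.
Qed.
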